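(* Let $\mathrm{AP}$ be finite and let $\phi(R)$ be a $\Delta^2_0$ formula (with a free 4-ary relation variable $R$) that is trace-order invariant. Then there exists a second-order sentence $\psi$ over the vocabulary $\{\le\}\cup\{P_i\mid p_i\in\mathrm{AP}\}$ such that for all countable trace sets $T$ over $\mathrm{AP}$: $$\mathcal M_T\models\psi\iff(\mathbb N,+,\times,\le,0,1)\models\phi(A_T/R).$$
   Context: $\mathrm{AP}=\{p_0,\dots\}$ is a set of atomic propositions; a trace over $\mathrm{AP}$ is $t\in(2^{\mathrm{AP}})^\omega$. $\mathcal M_T$ has domain $T\times\mathbb N$, $(t,n)\le(t',m)$ iff $t=t'$ and $n\le m$, and $P_i=\{(t,j)\mid p_i\in t(j)\}$. $\Delta^2_0$ denotes the set of second-order formulas over $\{+,\times,0,1,=,\le\}$, interpreted in the standard model of arithmetic. A countable team is given as an enumeration $T=(t_i)_{i\in I}$ with $I=\mathbb N$ or $I=\{0,\dots,n\}$ (distinct traces). Its encoding $A_T\subseteq\mathbb N^4$ consists of the tuples $(0,i,j,k)$ with $p_k\in t_i(j)$, together with $(1,n,n,n)$ where $n=|T|$, in case $T$ is finite. A formula $\phi(R)\in\Delta^2_0$ is trace-order invariant if for all countable teams $T=(t_i)_{i\in I}$ and all permutations $f\colon I\to I$, $(\mathbb N,+,\times,\le,0,1)\models\phi(A_T/R)\leftrightarrow\phi(A_{T^f}/R)$, where $T^f=(t_{f(i)})_{i\in I}$. *)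

(* Defs.v *)
From mathcomp Require Import all_boot.
From mathcomp Require Import boolp classical_sets functions cardinality.

Set Implicit Arguments.
Unset Strict Implicit.
Unset Printing Implicit Defensive.

Local Open Scope classical_set_scope.

Record vocabulary := Vocabulary {
  fun_sym : Type;
  farity : fun_sym -> nat;
  rel_sym : Type;
  rarity : rel_sym -> nat }.

Record structure (V : vocabulary) := Structure {
  carrier :> Type;
  interp_f : forall f : fun_sym V, (farity f).-tuple carrier -> carrier;
  interp_r : forall P : rel_sym V, set ((rarity P).-tuple carrier) }.

(* Syntax is well scoped: [formula V G n] has its free first-order variables
   among 'I_n (de Bruijn indices, 0 being the innermost binder) and its free
   relation variables in the list [G] of their arities. *)
Inductive term (V : vocabulary) (n : nat) : Type :=
| Var of 'I_n
| App (f : fun_sym V) of ('I_(farity f) -> term V n).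

Inductive relvar : seq nat -> nat -> Type :=
| RVHere (k : nat) (G : seq nat) : relvar (k :: G) k
| RVThere (k l : nat) (G : seq nat) of relvar G k : relvar (l :: G) k.

Inductive formula (V : vocabulary) : seq nat -> nat -> Type :=
| Equal G n of term V n & term V n : formula V G n
| Rel G n (P : rel_sym V) of ('I_(rarity P) -> term V n) : formula V G n
| RelVar G n k of relvar G k & ('I_k -> term V n) : formula V G n
| Not G n of formula V G n : formula V G n
| And G n of formula V G n & formula V G n : formula V G n
| Or G n of formula V G n & formula V G n : formula V G n
| Imp G n of formula V G n & formula V G n : formula V G n
| All1 G n of formula V G n.+1 : formula V G n
| Ex1 G n of formula V G n.+1 : formula V G n
| All2 G n (k : nat) of formula V (k :: G) n : formula V G n
| Ex2 G n (k : nat) of formula V (k :: G) n : formula V G n.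

Definition sentence (V : vocabulary) := formula V [::] 0.

Fixpoint rel_env (D : Type) (G : seq nat) : Type :=
  if G is k :: G' then (set (k.-tuple D) * rel_env D G')%type else unit.

Fixpoint rel_lookup (D : Type) (G : seq nat) (k : nat) (X : relvar G k) :
    rel_env D G -> set (k.-tuple D) :=
  match X with
  | RVHere _ _ => fun r => r.1
  | RVThere _ _ _ X' => fun r => rel_lookup X' r.2
  end.

Fixpoint eval (V : vocabulary) (M : structure V) (n : nat) (e : n.-tuple M)
    (t : term V n) : M :=
  match t with
  | Var i => tnth e i
  | App f ts => interp_f [tuple eval e (ts i) | i < farity f]
  end.

(* Full (standard) semantics: relation variables of arity [k] range over all
   subsets of [M ^ k]. *)
Fixpoint sat (V : vocabulary) (M : structure V) (G : seq nat) (n : nat)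
    (phi : formula V G n) : rel_env M G -> n.-tuple M -> Prop :=
  match phi in formula _ G n return rel_env M G -> n.-tuple M -> Prop with
  | Equal _ _ t u => fun r e => eval e t = eval e u
  | Rel _ _ P ts => fun r e => interp_r [tuple eval e (ts i) | i < rarity P]
  | RelVar _ _ k X ts => fun r e =>
      rel_lookup X r [tuple eval e (ts i) | i < k]
  | Not _ _ a => fun r e => ~ sat a r e
  | And _ _ a b => fun r e => sat a r e /\ sat b r e
  | Or _ _ a b => fun r e => sat a r e \/ sat b r e
  | Imp _ _ a b => fun r e => sat a r e -> sat b r e
  | All1 _ _ a => fun r e => forall d : M, sat a r [tuple of d :: e]
  | Ex1 _ _ a => fun r e => exists d : M, sat a r [tuple of d :: e]
  | All2 _ _ k a => fun r e => forall A : set (k.-tuple M), sat a (A, r) e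
  | Ex2 _ _ k a => fun r e => exists A : set (k.-tuple M), sat a (A, r) e
  end.

Definition models (V : vocabulary) (M : structure V) (psi : sentence V) : Prop :=
  sat (M := M) psi tt [tuple].

Inductive arith_fsym := AZero | AOne | AAdd | AMul.
Inductive arith_rsym := ALe.

Definition arith_voc : vocabulary := {|
  farity := fun f => match f with AZero | AOne => 0 | AAdd | AMul => 2 end;
  rarity := fun P => match P with ALe => 2 end |}.

Definition standard_arith : structure arith_voc := {|
  carrier := nat;
  interp_f := fun f =>
    match f return (@farity arith_voc f).-tuple nat -> nat with
    | AZero => fun=> 0
    | AOne => fun=> 1
    | AAdd => fun a => tnth a ord0 + tnth a ord_max
    | AMul => fun a => tnth a ord0 * tnth a ord_max
    end;
  interp_r := fun P =>
    match P return set ((@rarity arith_voc P).-tuple nat) with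
    | ALe => [set a : 2.-tuple nat | tnth a ord0 <= tnth a ord_max]
    end |}.

(* [phi(A/R)], where [R] is the only free variable of [phi]. *)
Definition arith_models (phi : formula arith_voc [:: 4] 0)
    (A : set (4.-tuple nat)) : Prop :=
  sat (M := standard_arith) phi (A, tt) [tuple].

(* AP = {p_0, ..., p_(m-1)}; [p_i] is represented by its index [i : 'I_m]. *)
Definition trace (m : nat) := nat -> {set 'I_m}.

Inductive trace_rsym (m : nat) := TLe | TP of 'I_m.

Definition trace_voc (m : nat) : vocabulary := {|
  farity := fun f : void => match f with end;
  rarity := fun P : trace_rsym m => match P with TLe => 2 | TP _ => 1 end |}.

Definition trace_structure (m : nat) (T : set (trace m)) :
    structure (trace_voc m) := {|
  carrier := (T * nat)%type;
  interp_f := fun f : fun_sym (trace_voc m) => match f : void with end;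
  interp_r := fun P =>
    match P return set ((@rarity (trace_voc m) P).-tuple (T * nat)) with
    | TLe => [set a : 2.-tuple (T * nat) |
        (tnth a ord0).1 = (tnth a ord_max).1 /\
        (tnth a ord0).2 <= (tnth a ord_max).2]
    | TP i => [set a : 1.-tuple (T * nat) |
        i \in (val (tnth a ord0).1 : trace m) (tnth a ord0).2]
    end |}.

(* [Initial n] stands for {0, ..., n}, so teams are nonempty. *)
Inductive index_set := Initial of nat | AllNat.

Definition index_type (c : index_set) : Type :=
  match c with Initial n => 'I_n.+1 | AllNat => nat end.

Definition index_val (c : index_set) : index_type c -> nat :=
  match c with Initial n => @nat_of_ord n.+1 | AllNat => id end.

Record team (m : nat) := Team {
  team_index : index_set;
  team_trace :> index_type team_index -> trace m;
  team_inj : injective team_trace }.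

Definition team_set (m : nat) (T : team m) : set (trace m) := range T.

Definition team_perm (m : nat) (T : team m)
    (f : index_type (team_index T) -> index_type (team_index T))
    (bij_f : bijective f) : team m :=
  Team (inj_comp (@team_inj m T) (bij_inj bij_f)).

Definition encoding (m : nat) (T : team m) : set (4.-tuple nat) :=
  [set a | (exists (i : index_type (team_index T)) (j : nat) (k : 'I_m),
              k \in T i j /\ a = [tuple 0; index_val i; j; val k]) \/
           (exists n : nat,
              (team_set T #= `I_n)%card /\ a = [tuple 1; n; n; n])].

Definition trace_order_invariant (m : nat) (phi : formula arith_voc [:: 4] 0) :
    Prop :=
  forall (T : team m)
    (f : index_type (team_index T) -> index_type (team_index T))
    (bij_f : bijective f),
  arith_models phi (encoding T) <->
  arith_models phi (encoding (team_perm bij_f)).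

(* Main.v *)
Require Import Defs.
From mathcomp Require Import all_boot.
From mathcomp Require Import boolp classical_sets functions cardinality.
From Stdlib Require Import Setoid.

(** The domain of [M_T] is countably infinite, so a second-order sentence can
    guess a successor relation satisfying the second-order Peano axioms, i.e.,
    an isomorphism [h] of [M_T] with the natural numbers, together with the
    corresponding addition and multiplication. It also guesses the position of
    each point in its trace, an enumeration of the traces by an initial segment
    of the numbers, and the preimage under [h] of the encoding of the team in
    this enumeration; all of these are pinned down by first-order axioms.
    Evaluating [phi] in this copy of arithmetic gives [phi(A_{T^f})] for the
    guessed permutation [f], and trace-order invariance removes the dependence
    on [f]. *)

Set Implicit Arguments.
Unset Strict Implicit.
Unset Printing Implicit Defensive.

(** * Formulas and arithmetic inside a structure *)

Section Connectives.
Variable V : vocabulary.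

Definition atom G n k (X : relvar G k) (vs : k.-tuple 'I_n) : formula V G n :=
  RelVar X (fun i => Var V (tnth vs i)).

Definition atom1 G n (X : relvar G 1) (x : 'I_n) := atom X [tuple x].
Definition atom2 G n (X : relvar G 2) (x y : 'I_n) := atom X [tuple x; y].
Definition atom3 G n (X : relvar G 3) (x y z : 'I_n) :=
  atom X [tuple x; y; z].
Definition atom4 G n (X : relvar G 4) (x y z w : 'I_n) :=
  atom X [tuple x; y; z; w].
Definition eq_atom G n (x y : 'I_n) := Equal G (Var V x) (Var V y).

Definition iff_formula G n (a b : formula V G n) : formula V G n :=
  And (Imp a b) (Imp b a).

Definition top_formula G n : formula V G n :=
  All1 (Equal G (Var V ord0) (Var V ord0)).

Definition conj_ord G n k (F : 'I_k -> formula V G n) : formula V G n :=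
  foldr (fun i => And (F i)) (top_formula G n) (enum 'I_k).

Definition disj_ord G n k (F : 'I_k -> formula V G n) : formula V G n :=
  foldr (fun i => Or (F i)) (Not (top_formula G n)) (enum 'I_k).

(** The block is innermost: its variables are the [lshift] indices of ['I_(k + n)], the outer ones
    the [rshift] indices. *)
Fixpoint exists_block G n k : formula V G (k + n) -> formula V G n :=
  match k with
  | 0 => id
  | k'.+1 => fun F => exists_block (k := k') (Ex1 F)
  end.

Variable M : structure V.
Implicit Types (n k : nat).

Lemma sat_atom G n k (X : relvar G k) (vs : k.-tuple 'I_n)
    (r : rel_env M G) (e : n.-tuple M) :
  sat (atom X vs) r e = rel_lookup X r (map_tuple (tnth e) vs).
Proof.
by congr (rel_lookup X r _); apply: eq_from_tnth => i; rewrite tnth_mktuple tnth_map.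
Qed.

Section SatAtoms.
Variables (G : seq nat) (n : nat) (r : rel_env M G) (e : n.-tuple M).

Lemma sat_atom1 (X : relvar G 1) x :
  sat (atom1 X x) r e <-> rel_lookup X r [tuple tnth e x].
Proof. by rewrite sat_atom; split; congr (rel_lookup X r _); apply: val_inj. Qed.

Lemma sat_atom2 (X : relvar G 2) x y :
  sat (atom2 X x y) r e <-> rel_lookup X r [tuple tnth e x; tnth e y].
Proof. by rewrite sat_atom; split; congr (rel_lookup X r _); apply: val_inj. Qed.

Lemma sat_atom3 (X : relvar G 3) x y z :
  sat (atom3 X x y z) r e <->
  rel_lookup X r [tuple tnth e x; tnth e y; tnth e z].
Proof. by rewrite sat_atom; split; congr (rel_lookup X r _); apply: val_inj. Qed.

Lemma sat_atom4 (X : relvar G 4) x y z w :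
  sat (atom4 X x y z w) r e <->
  rel_lookup X r [tuple tnth e x; tnth e y; tnth e z; tnth e w].
Proof. by rewrite sat_atom; split; congr (rel_lookup X r _); apply: val_inj. Qed.

End SatAtoms.

Lemma sat_conj_ord G n k (F : 'I_k -> formula V G n)
    (r : rel_env M G) (e : n.-tuple M) :
  sat (conj_ord F) r e <-> forall i, sat (F i) r e.
Proof.
rewrite /conj_ord; split=> [H i|H].
  have: i \in enum 'I_k by rewrite mem_enum.
  elim: (enum _) H => //= j s IH [Hj Hs]; rewrite inE => /predU1P[->//|].
  exact: IH.
by elim: (enum _) => //= j s IH.
Qed.

Lemma sat_disj_ord G n k (F : 'I_k -> formula V G n)
    (r : rel_env M G) (e : n.-tuple M) :
  sat (disj_ord F) r e <-> exists i, sat (F i) r e.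
Proof.
rewrite /disj_ord; split=> [|[i Hi]].
  by elim: (enum _) => [|j s IH] /=; [case|case=> [?|/IH//]; exists j].
have: i \in enum 'I_k by rewrite mem_enum.
elim: (enum _) => //= j s IH; rewrite inE => /predU1P[<-|/IH]; first by left.
by right.
Qed.

Lemma sat_exists_block G n k (F : formula V G (k + n)) (r : rel_env M G)
    (e : n.-tuple M) :
  sat (exists_block F) r e <-> exists d : k.-tuple M, sat F r [tuple of d ++ e].
Proof.
elim: k F => [|k IH] F /=.
  have E (d : 0.-tuple M) : [tuple of d ++ e] = e.
    by apply: val_inj; rewrite /= (tuple0 d).
  split=> [H|[d]]; last by rewrite E.
  by exists [tuple]; rewrite E.
rewrite IH /=; split=> [[d [x H]]|[d H]].
  exists [tuple of x :: d].
  by congr (sat F r _): H; apply: val_inj.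
exists [tuple of behead d], (thead d).
by congr (sat F r _): H; apply: val_inj; rewrite /= {1}(tuple_eta d).
Qed.

End Connectives.

Arguments atom {V G n k}.
Arguments atom1 {V G n}.
Arguments atom2 {V G n}.
Arguments atom3 {V G n}.
Arguments atom4 {V G n}.
Arguments eq_atom {V} G {n}.

(** * Joining relation environments and pulling them back *)

Section Environments.
Variable B : seq nat.

(** The fixed relations [B] stand behind the variables [G] of the translated formula. A second-order
    binder extends [G] at the front, and [(k :: G) ++ B] computes to [k :: (G ++ B)], so binders
    translate to binders without a cast. *)
Fixpoint relvar_inl G k (X : relvar G k) : relvar (G ++ B) k :=
  match X in relvar G k return relvar (G ++ B) k with
  | RVHere k G => RVHere k (G ++ B)
  | RVThere _ l _ X' => RVThere l (relvar_inl X')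
  end.

Fixpoint relvar_inr G k (X : relvar B k) : relvar (G ++ B) k :=
  match G with
  | [::] => X
  | l :: G' => RVThere l (relvar_inr G' X)
  end.

Fixpoint env_cat D G : rel_env D G -> rel_env D B -> rel_env D (G ++ B) :=
  match G with
  | [::] => fun _ b => b
  | _ :: _ => fun r b => (r.1, env_cat r.2 b)
  end.

Lemma rel_lookup_inl D G k (X : relvar G k) (r : rel_env D G) b :
  rel_lookup (relvar_inl X) (env_cat r b) = rel_lookup X r.
Proof. by elim: X r => //= ? ? ? ? IH r; rewrite IH. Qed.

Lemma rel_lookup_inr D G k (X : relvar B k) (r : rel_env D G) b :
  rel_lookup (relvar_inr G X) (env_cat r b) = rel_lookup X b.
Proof. by elim: G r => //= ? ? IH r; rewrite IH. Qed.

(** Relations are moved against [h], which needs no inverse in the definition; for bijective [h]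
    every relation on [D] arises this way. *)
Fixpoint env_preimage D D' (h : D -> D') G : rel_env D' G -> rel_env D G :=
  match G with
  | [::] => id
  | _ :: _ => fun r => ((fun a => r.1 (map_tuple h a)), env_preimage h r.2)
  end.

Lemma rel_lookup_preimage D D' (h : D -> D') G k (X : relvar G k)
    (r : rel_env D' G) a :
  rel_lookup X (env_preimage h r) a = rel_lookup X r (map_tuple h a).
Proof. by elim: X r a => //= ? ? ? ? IH r a; rewrite IH. Qed.

End Environments.

(** * Interpreting arithmetic formulas in a copy of arithmetic *)

Section Translation.
Variables (V : vocabulary) (B : seq nat) (add mul : relvar B 3).

(** The constants are recovered from the two graphs: zero is the only solution of o + o = o, and one
    is the only nonzero solution of o * o = o. *)
Definition graph_op G n (f : arith_fsym) :
    ('I_(@farity arith_voc f) -> 'I_n) -> 'I_n -> formula V (G ++ B) n :=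
  match f return ('I_(@farity arith_voc f) -> 'I_n) -> _ with
  | AZero => fun _ o => atom3 (relvar_inr G add) o o o
  | AOne => fun _ o => And (atom3 (relvar_inr G mul) o o o)
                           (Not (atom3 (relvar_inr G add) o o o))
  | AAdd => fun a o => atom3 (relvar_inr G add) (a ord0) (a ord_max) o
  | AMul => fun a o => atom3 (relvar_inr G mul) (a ord0) (a ord_max) o
  end.

Definition le_formula G n (x y : 'I_n) : formula V (G ++ B) n :=
  Ex1 (atom3 (relvar_inr G add) (lift ord0 x) ord0 (lift ord0 y)).

(* [graph G t s o] says that variable [o] holds the value of [t], where
   variable [i] of [t] is represented by variable [s i]. *)
Fixpoint graph G n (t : term arith_voc n) N (s : 'I_n -> 'I_N) (o : 'I_N) :
    formula V (G ++ B) N :=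
  match t with
  | Var i => Equal (G ++ B) (Var V (s i)) (Var V o)
  | App f ts => exists_block (k := farity f) (And
      (conj_ord (fun i => graph G (ts i) (fun j => rshift _ (s j)) (lshift N i)))
      (graph_op G (f := f) (fun i => lshift N i) (rshift _ o)))
  end.

(** The target vocabulary may lack function symbols, so terms cannot stay inside atoms; fresh
    variables name their values first. *)
Definition with_values G n k (ts : 'I_k -> term arith_voc n)
    (body : formula V (G ++ B) (k + n)) : formula V (G ++ B) n :=
  exists_block (And
    (conj_ord (fun i => graph G (ts i) (fun j => rshift k j) (lshift n i))) body).

Fixpoint translate G n (phi : formula arith_voc G n) : formula V (G ++ B) n :=
  match phi in formula _ G n return formula V (G ++ B) n with
  | Equal G n t u => Ex1 (And (graph G t (lift ord0) ord0)
                              (graph G u (lift ord0) ord0))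
  | Rel G n P ts => with_values ts
      match P return formula V (G ++ B) (@rarity arith_voc P + n) with
      | ALe => le_formula G (lshift n (ord0 : 'I_2)) (lshift n (ord_max : 'I_2))
      end
  | RelVar G n k X ts =>
      with_values ts (atom (relvar_inl B X) [tuple lshift n i | i < k])
  | Not _ _ a => Not (translate a)
  | And _ _ a b => And (translate a) (translate b)
  | Or _ _ a b => Or (translate a) (translate b)
  | Imp _ _ a b => Imp (translate a) (translate b)
  | All1 _ _ a => All1 (translate a)
  | Ex1 _ _ a => Ex1 (translate a)
  | All2 G n k a => All2 (translate a)
  | Ex2 G n k a => Ex2 (translate a)
  end.

Variables (M : structure V) (h : M -> nat) (b : rel_env M B).
Hypothesis h_bij : bijective h.
Hypothesis addP : forall x y z : M,
  rel_lookup add b [tuple x; y; z] <-> h x + h y = h z.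
Hypothesis mulP : forall x y z : M,
  rel_lookup mul b [tuple x; y; z] <-> h x * h y = h z.

Lemma sat_graph_op G n f (a : 'I_(@farity arith_voc f) -> 'I_n) (o : 'I_n)
    (r : rel_env M G) (e : n.-tuple M) :
  sat (graph_op G a o) (env_cat r b) e <->
  interp_f (s := standard_arith) [tuple h (tnth e (a i)) | i < farity f] =
  h (tnth e o).
Proof.
case: f a => a; rewrite /graph_op.
- rewrite sat_atom3 rel_lookup_inr addP /=.
  by case: (h _) => // k; split=> // /eqP; rewrite -[X in _ == X]addn0 eqn_add2l.
- have sat_And (c d : formula V (G ++ B) n) r' :
    sat (And c (Not d)) r' e = (sat c r' e /\ ~ sat d r' e) by [].
  rewrite sat_And !sat_atom3 !rel_lookup_inr addP mulP /=.
  case: (h _) => [|[|k]]; first by split=> [[]|].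
    by split.
  by split=> [[/eqP]|//]; rewrite -[X in _ == X]muln1 eqn_pmul2l.
- by rewrite sat_atom3 rel_lookup_inr addP /= !tnth_mktuple.
- by rewrite sat_atom3 rel_lookup_inr mulP /= !tnth_mktuple.
Qed.

Lemma sat_le_formula G n (x y : 'I_n) (r : rel_env M G) (e : n.-tuple M) :
  sat (le_formula G x y) (env_cat r b) e <-> h (tnth e x) <= h (tnth e y).
Proof.
have [g _ gK] := h_bij.
have E d : sat (atom3 (relvar_inr G add) (lift ord0 x) ord0 (lift ord0 y))
      (env_cat r b) [tuple of d :: e] <->
    h (tnth e x) + h d = h (tnth e y).
  by rewrite sat_atom3 rel_lookup_inr addP !tnthS tnth0.
split=> [[d /E <-]|Hle]; first by rewrite leq_addr.
exists (g (h (tnth e y) - h (tnth e x))); apply/E.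
by rewrite gK subnKC.
Qed.

Lemma sat_graph G n (t : term arith_voc n) N (s : 'I_n -> 'I_N) (o : 'I_N)
    (r : rel_env M G) (e : N.-tuple M) (e' : n.-tuple standard_arith) :
  (forall i, tnth e' i = h (tnth e (s i))) ->
  sat (graph G t s o) (env_cat r b) e <-> eval e' t = h (tnth e o).
Proof.
have h_inj := bij_inj h_bij.
elim: t N s o e => [i|f ts IH] N s o e He /=.
  by rewrite He; split=> [->|/h_inj].
rewrite sat_exists_block.
have Hr (d : (farity f).-tuple M) i :
    tnth e' i = h (tnth [tuple of d ++ e] (rshift (farity f) (s i))).
  by rewrite tnth_rshift He.
have [g hK gK] := h_bij.
split=> [[d [/sat_conj_ord Hts /sat_graph_op]]|Ho].
  rewrite tnth_rshift => <-; congr (@interp_f _ standard_arith f _).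
  apply: eq_from_tnth => i.
  rewrite !tnth_mktuple; apply/(IH i _ _ _ _ (Hr d)); exact: Hts.
(* The block variables have to hold the [h]-preimages of the argument values. *)
exists [tuple g (eval e' (ts i)) | i < farity f]; split.
  apply/sat_conj_ord => i; apply/(IH i _ _ _ _ (Hr _)).
  by rewrite tnth_lshift tnth_mktuple gK.
apply/sat_graph_op; rewrite tnth_rshift -Ho; congr (@interp_f _ standard_arith f _).
by apply: eq_from_tnth => i; rewrite !tnth_mktuple tnth_lshift tnth_mktuple gK.
Qed.

Lemma sat_with_values G n k (ts : 'I_k -> term arith_voc n)
    (body : formula V (G ++ B) (k + n)) (r : rel_env M G) (e : n.-tuple M)
    (Q : set (k.-tuple nat)) :
  (forall d : k.-tuple M,
    sat body (env_cat r b) [tuple of d ++ e] <-> Q (map_tuple h d)) ->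
  sat (with_values ts body) (env_cat r b) e <->
  Q [tuple eval (M := standard_arith) (map_tuple h e) (ts i) | i < k].
Proof.
move=> HQ; have [g hK gK] := h_bij; rewrite /with_values sat_exists_block.
have He (d : k.-tuple M) i :
    tnth (map_tuple h e) i = h (tnth [tuple of d ++ e] (rshift k i)).
  by rewrite tnth_map tnth_rshift.
split=> [[d [/sat_conj_ord Hts /HQ]]|].
  congr (Q _); apply: eq_from_tnth => i; rewrite tnth_map tnth_mktuple.
  by have /(sat_graph _ _ _ (He d)) := Hts i; rewrite tnth_lshift.
set v := mktuple _ => Hv; exists (map_tuple g v); split.
  apply/sat_conj_ord => i; apply/(sat_graph _ _ _ (He _)).
  by rewrite tnth_lshift tnth_map gK tnth_mktuple.
apply/HQ; congr (Q _): Hv; apply: eq_from_tnth => i.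
by rewrite !tnth_map gK.
Qed.

(** By [addP] and [mulP], [h] is an isomorphism onto the standard model, so quantifiers on both
    sides range over corresponding elements and relations; the values of terms are matched by
    [sat_graph]. *)
Lemma sat_translate G n (phi : formula arith_voc G n)
    (r : rel_env standard_arith G) (e : n.-tuple M) :
  sat (translate phi) (env_cat (env_preimage h r) b) e <->
  sat phi r (map_tuple h e).
Proof.
have [g hK gK] := h_bij.
have map_cons k (d : M) (v : k.-tuple M) :
    map_tuple h [tuple of d :: v] = [tuple of h d :: map_tuple h v].
  exact: val_inj.
(* Every relation on [M] is a preimage under [h], which lets the second-order quantifiers pass
   between the two sides. *)
have preimage_image k (A : set (k.-tuple M)) :
    A = (fun a => A (map_tuple g (map_tuple h a))).
  apply/funext => a; congr (A _); apply: eq_from_tnth => i.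
  by rewrite !tnth_map hK.
elim: phi r e => {G n} [G n t u|G n P ts|G n k X ts|G n a IHa|G n a IHa c IHc
  |G n a IHa c IHc|G n a IHa c IHc|G n a IHa|G n a IHa|G n k a IHa|G n k a IHa] r e.
- have He d i : tnth (map_tuple h e) i = h (tnth [tuple of d :: e] (lift ord0 i)).
    by rewrite tnth_map tnthS.
  split=> [[d []]|/= Htu].
    by move=> /(sat_graph _ _ _ (He d)) Ht /(sat_graph _ _ _ (He d)) Hu; rewrite /= Ht.
  exists (g (eval (M := standard_arith) (map_tuple h e) t)).
  by split; apply/(sat_graph _ _ _ (He _)); rewrite tnth0 gK.
- apply: (@sat_with_values _ _ _ ts _ _ _ (@interp_r _ standard_arith P)) => d.
  case: P ts d => ts d; rewrite sat_le_formula.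
  by rewrite !tnth_lshift /= !tnth_map.
- apply: (@sat_with_values _ _ _ ts _ _ _ (rel_lookup X r)) => d.
  rewrite sat_atom rel_lookup_inl rel_lookup_preimage.
  set v := map_tuple (tnth _) _; suff -> : v = d by [].
  by apply: eq_from_tnth => i; rewrite tnth_map tnth_mktuple tnth_lshift.
- by rewrite /= IHa.
- by rewrite /= IHa IHc.
- by rewrite /= IHa IHc.
- by rewrite /= IHa IHc.
- split=> H d; last by apply/IHa; rewrite map_cons.
  by rewrite -(gK d) -map_cons; apply/IHa.
- split=> [[d /IHa]|[d]]; first by rewrite map_cons; exists (h d).
  by rewrite -(gK d) -map_cons => /IHa; exists (g d).
- split=> H A.
    exact: (IHa (A, r) e).1 (H (fun a => A (map_tuple h a))).
  rewrite (preimage_image _ A).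
  exact: (IHa (fun v => A (map_tuple g v), r) e).2 (H _).
- split=> [[A]|[A HA]].
    rewrite (preimage_image _ A) => HA; exists (fun v => A (map_tuple g v)).
    exact: (IHa (fun v => A (map_tuple g v), r) e).1 HA.
  exists (fun a => A (map_tuple h a)).
  exact: (IHa (A, r) e).2 HA.
Qed.

End Translation.

(** * Characterising the guessed relations *)

Section Peano.
Variable M : Type.
Implicit Types (S : M -> M -> Prop) (h : M -> nat).

(** Successor is a relation because the trace vocabulary has no function symbols. Sets of 1-tuples
    match the range of a unary relation variable. *)
Definition successor_axioms S :=
  [/\ forall x, exists y, S x y,
      forall x y z, S x y -> S x z -> y = z,
      forall x y z, S x z -> S y z -> x = y &
      exists z, ~ (exists x, S x z) /\
        forall A : set (1.-tuple M), A [tuple z] ->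
          (forall x y, A [tuple x] -> S x y -> A [tuple y]) ->
          forall x, A [tuple x]].

Fixpoint numeral S k x :=
  match k with
  | 0 => ~ exists w, S w x
  | k'.+1 => exists w, S w x /\ numeral S k' w
  end.

(** Dedekind's categoricity theorem: iterating the successor from the least element is injective by
    the first-order axioms and surjective by induction; [h] inverts it. *)
Lemma successor_axiomsP S :
  successor_axioms S <->
  exists2 h, bijective h & forall x y, S x y <-> h y = (h x).+1.
Proof.
split=> [[/choice[s sP] S_fun S_inj [z [z_min S_ind]]]|[h [g hK gK] hP]].
  pose g n := iter n s z.
  have g_inj : injective g.
    elim=> [|a IH] [|b] //= E; first by case: z_min; exists (g b); rewrite [X in S _ X]E.
      by case: z_min; exists (g a); rewrite -[X in S _ X]E.
    by rewrite (IH b) //; apply: S_inj (sP _) _; rewrite [s (g a)]E.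
  have /choice[h gh] x : exists n, g n = x.
    (* Induction is applied to the set of iterates of [z]. *)
    apply: (S_ind (fun t => exists n, g n = thead t)); first by exists 0.
    move=> {}x y [n gx] Sxy; exists n.+1.
    have {}gx : g n = x := gx.
    by apply: S_fun Sxy; rewrite -gx; apply: sP.
  exists h; first by exists g => // n; apply: g_inj.
  move=> x y; split=> [Sxy|hy].
    by apply: g_inj; rewrite gh /= gh; apply: S_fun Sxy (sP x).
  by rewrite -(gh y) hy /= gh.
split=> [x|x y z|x y z|].
- by exists (g (h x).+1); rewrite hP gK.
- by rewrite !hP => <- /(can_inj hK).
- by rewrite !hP => -> [] /(can_inj hK).
exists (g 0); split=> [[x]|A A0 AS x]; first by rewrite hP gK.
rewrite -(hK x); elim: (h x) => // n IH; apply: AS IH _.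
by rewrite hP !gK.
Qed.

Section Arithmetic.
Variables (S : M -> M -> Prop) (h : M -> nat).
Hypothesis h_bij : bijective h.
Hypothesis hP : forall x y, S x y <-> h y = (h x).+1.

Lemma numeralP k x : numeral S k x <-> h x = k.
Proof.
have [g hK gK] := h_bij.
elim: k x => [|k IH] x /=.
  split=> [Hx|Hx [w /hP]]; last by rewrite Hx.
  by case E: (h x) => [//|n]; case: Hx; exists (g n); rewrite hP gK.
split=> [[w [/hP -> /IH ->]] //|Hx].
by exists (g k); rewrite hP IH gK.
Qed.

(** The recursion equations determine [Add] by induction on [h y]. They are stated as an equivalence
    since either implication alone would bound [Add] from one side only. *)
Lemma addition_axiomP (Add : M -> M -> M -> Prop) :
  (forall x y z, Add x y z <->
    (numeral S 0 y /\ x = z) \/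
    exists y' z', S y' y /\ S z' z /\ Add x y' z') <->
  forall x y z, Add x y z <-> h x + h y = h z.
Proof.
have [g hK gK] := h_bij; have h_inj := can_inj hK.
split=> AddP x y z.
  have [n yn] : exists n, h y = n by exists (h y).
  elim: n y yn z => [|n IH] y yn z; rewrite AddP numeralP yn.
    rewrite addn0; split=> [[[_ ->]//|[? [? [/hP]]]]|/h_inj]; last by left.
    by rewrite yn.
  split=> [[[]//|[y' [z' [/hP yy' [/hP -> yz']]]]]|hz].
    have yn' : h y' = n by move: yn; rewrite yy' => -[].
    by rewrite addnS -((IH _ yn' _).1 yz') yn'.
  right; exists (g n), (g (h x + n)).
  by rewrite !hP IH !gK // yn -hz addnS.
rewrite AddP numeralP; split=> [hz|[[-> ->]|]]; last 2 first.
- by rewrite addn0.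
- by move=> [y' [z' [/hP -> [/hP -> /AddP <-]]]]; rewrite addnS.
case yn: (h y) hz => [|n] hz.
  by left; split=> //; apply: h_inj; rewrite -hz addn0.
right; exists (g n), (g (h x + n)).
by rewrite !hP AddP !gK // yn -hz addnS.
Qed.

Lemma multiplication_axiomP (Add Mul : M -> M -> M -> Prop) :
  (forall x y z, Add x y z <-> h x + h y = h z) ->
  (forall x y z, Mul x y z <->
    (numeral S 0 y /\ numeral S 0 z) \/
    exists y' z', S y' y /\ Mul x y' z' /\ Add z' x z) <->
  forall x y z, Mul x y z <-> h x * h y = h z.
Proof.
have [g hK gK] := h_bij; have h_inj := can_inj hK.
move=> AddP; split=> MulP x y z.
  have [n yn] : exists n, h y = n by exists (h y).
  elim: n y yn z => [|n IH] y yn z; rewrite MulP !numeralP yn.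
    rewrite muln0; split=> [[[_ ->]//|[? [? [/hP]]]]|->]; last by left.
    by rewrite yn.
  split=> [[[]//|[y' [z' [/hP yy' [yz' /AddP <-]]]]]|hz].
    have yn' : h y' = n by move: yn; rewrite yy' => -[].
    by rewrite mulnSr -((IH _ yn' _).1 yz') yn'.
  right; exists (g n), (g (h x * n)).
  by rewrite hP AddP IH !gK // yn -hz mulnSr.
rewrite MulP !numeralP; split=> [hz|[[-> ->]|]]; last 2 first.
- by rewrite muln0.
- by move=> [y' [z' [/hP -> [/MulP zz' /AddP <-]]]]; rewrite mulnSr zz'.
case yn: (h y) hz => [|n] hz.
  by left; split=> //; rewrite -hz muln0.
right; exists (g n), (g (h x * n)).
by rewrite hP AddP MulP !gK // yn -hz mulnSr.
Qed.

End Arithmetic.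
End Peano.

(** * Index sets and their enumerations *)

Section Indices.
Implicit Types c : index_set.

Lemma index_val_inj c : injective (@index_val c).
Proof. by case: c => [n|] //=; apply: ord_inj. Qed.

Lemma index_val_down c (k : index_type c) n :
  index_val k = n.+1 -> exists l : index_type c, index_val l = n.
Proof.
case: c k => [N|] k E /=; last by exists n.
have lt_n : n < N.+1 by rewrite ltnW // -E ltn_ord.
by exists (Ordinal lt_n).
Qed.

(* An injection onto an initial segment of [nat] reaches exactly the indices:
   by the pigeonhole principle it can neither overshoot nor stop short. *)
Lemma enumeration_perm c (K : index_type c -> nat) :
  injective K ->
  (forall i n, K i = n.+1 -> exists j, K j = n) ->
  exists2 p : index_type c -> index_type c,
    bijective p & forall i, index_val (p i) = K i.
Proof.
move=> K_inj K_down.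
have K_below i n : n <= K i -> exists j, K j = n.
  move=> le_n; rewrite -(subKn le_n); elim: (K i - n) => [|d [j Kj]].
    by exists i; rewrite subn0.
  have [lt_d|le_d] := ltnP d (K i).
    by apply: (K_down j); rewrite Kj subnSK.
  (* Once [d] has reached [K i], truncated subtraction stays at 0 and the same index serves
     again. *)
  exists j; rewrite Kj subnS.
  by move: le_d; rewrite -subn_eq0 => /eqP->.
case: c K K_inj K_down K_below => [N|] K K_inj K_down K_below.
  have K_lt i : K i < N.+1.
    rewrite ltnNge; apply/negP => le_N.
    (* Otherwise 0, ..., N+1 would all be attained: N+2 values from N+1 indices. *)
    have /choice[J KJ] (b : 'I_N.+2) : exists j, K j = b.
      by apply: (K_below i); rewrite (leq_trans _ le_N) // -ltnS ltn_ord.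
    have J_inj : injective J by move=> a b E; apply: ord_inj; rewrite -!KJ E.
    by have := leq_card J J_inj; rewrite !card_ord ltnn.
  exists (fun i => Ordinal (K_lt i)) => //.
  by apply: injF_bij => i j [] /K_inj.
have /choice[g Kg] b : exists i, K i = b.
  apply: contrapT => nb.
  (* The values are closed downwards, so a missed [b] bounds all of them; then [b + 1] indices would
     inject into [b] numbers. *)
  have K_lt i : K i < b.
    by rewrite ltnNge; apply/negP => /K_below.
  pose J (i : 'I_b.+1) := Ordinal (K_lt i).
  have J_inj : injective J by move=> i j [] /K_inj /ord_inj.
  by have := leq_card J J_inj; rewrite !card_ord ltnn.
by exists K => //; exists g => // i; apply: K_inj.
Qed.

End Indices.

(** * Order, positions and trace numbering in the structure of a team *)

Section TeamStructure.
Variables (m : nat) (T : team m).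
Let M := (team_set T * nat)%type.
Let index := index_type (team_index T).
Implicit Types (x y z : M) (h : M -> nat) (S I Pos : M -> M -> Prop).

Definition trace_le x y := x.1 = y.1 /\ x.2 <= y.2.

(** Here [y] is the lower point, the immediate predecessor of [x] on its trace, expressed by the
    order alone. *)
Definition covers x y :=
  trace_le y x /\ y <> x /\ forall z, trace_le z x -> z = x \/ trace_le z y.

(** The initial point stands for the whole trace; only its first component is ever compared. *)
Definition trace_point (k : index) : M :=
  (SigSub (mem_set (imageT T k)), 0).

Lemma trace_pointP x : exists k, x.1 = (trace_point k).1.
Proof.
by case: x => -[t tT] n; have [k _ Tk] := set_mem tT; exists k; apply: val_inj.
Qed.

Lemma trace_point_inj k l : (trace_point k).1 = (trace_point l).1 -> k = l.
Proof. by move=> /(congr1 val) /= /(@team_inj _ T). Qed.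

(** This makes lying on a common trace definable from the order. *)
Lemma comparableE x y : trace_le x y \/ trace_le y x <-> x.1 = y.1.
Proof.
split=> [[] []//|xy]; case/orP: (leq_total x.2 y.2) => le_xy; [left|right];
  by split.
Qed.

Lemma first_position x : (forall y, trace_le y x -> y = x) <-> x.2 = 0.
Proof.
split=> [min_x|x0 y [y1]]; first by rewrite -(min_x (x.1, 0)).
by rewrite x0 leqn0 => /eqP y0; apply: injective_projections; rewrite // y0.
Qed.

Lemma coversP x y : covers x y <-> y.1 = x.1 /\ x.2 = y.2.+1.
Proof.
case: x y => [t n] [u k]; split=> [[[/= -> le_kn] [ne covered]]|[/= -> ->]].
  split=> //; have lt_kn : k < n.
    by rewrite ltn_neqAle le_kn andbT; apply: contra_notN ne => /eqP->.
  (* The covering condition is tested at the point just below [x]; [lt_kn] excludes n = 0, where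
     [n.-1] would be [x] itself. *)
  have [|E|[_]] := covered (t, n.-1); first by split=> //=; apply: leq_pred.
    by move: lt_kn; case: E; case: (n) => //= n' /n_Sn.
  by case: (n) lt_kn => //= n' lt_k le_n; congr _.+1; apply/eqP; rewrite eqn_leq le_n.
split; first by split=> //=.
split=> [[/eqP]|[v j] [/= -> le_j]]; first by rewrite ltn_eqF.
by move: le_j; rewrite leq_eqVlt => /predU1P[->|]; [left|right].
Qed.

(** Points inject into pairs of an index and a position, so there are countably many. A single trace
    already contributes infinitely many, and there is one because teams are nonempty. *)
Lemma exists_enumeration : exists h, bijective h.
Proof.
have enum_M : ([set: M] #= [set: nat])%card.
  apply: eq_card_nat.
    apply/countable_injP.
    have /choice[f fP] x := trace_pointP x.
    exists (fun x => pickle (index_val (f x), x.2)) => x y _ _.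
    move/(pcan_inj pickleK) => [/index_val_inj E x2].
    by apply: injective_projections => //; rewrite fP E -fP.
  apply/infiniteP.
  have k : index by rewrite /index; case: (team_index T) => [n|]; [exact: ord0|exact: 0].
  pose F n : M := ((trace_point k).1, n).
  have F_inj : {in [set: nat]%classic &, injective F} by move=> a b _ _ [].
  rewrite -(card_le_eql (inj_card_eq F_inj)).
  exact: subset_card_le.
have /pcard_eqP[h] := enum_M.
by exists h; rewrite -setTT_bijective; apply: bij.
Qed.

Variables (S : M -> M -> Prop) (h : M -> nat).
Hypothesis h_bij : bijective h.
Hypothesis hP : forall x y, S x y <-> h y = (h x).+1.

(** As for addition, the equivalence is a recursion, here along a trace: [Pos] is determined by
    induction on [x.2]. *)
Lemma position_axiomP Pos :
  (forall x j, Pos x j <->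
    ((forall y, trace_le y x -> y = x) /\ numeral S 0 j) \/
    exists y i, covers x y /\ S i j /\ Pos y i) <->
  forall x j, Pos x j <-> h j = x.2.
Proof.
have [g hK gK] := h_bij.
split=> PosP x j; last first.
  rewrite PosP first_position (numeralP h_bij hP); split=> [jx|[[-> //]|]].
    case xn: x.2 jx => [|n] jx; first by left.
    right; exists (x.1, n), (g n).
    by rewrite coversP hP PosP gK /= xn.
  by move=> [y [i [/coversP [_ ->] [/hP -> /PosP ->]]]].
have [n xn] : exists n, x.2 = n by exists x.2.
elim: n x xn j => [|n IH] x xn j; rewrite PosP first_position (numeralP h_bij hP) xn.
  by split=> [[[]//|[y [i [/coversP[_]]]]]|->]; [rewrite xn|left].
split=> [[[]//|[y [i [/coversP[_ xy] [/hP -> Posy]]]]]|jn].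
  have yn : y.2 = n by move: xn; rewrite xy => -[].
  by rewrite ((IH y yn _).1 Posy) yn.
right; exists (x.1, n), (g n).
by rewrite coversP hP IH // gK jn xn.
Qed.

(** The second axiom makes the numbering constant on each trace and injective across traces, the
    third makes its range closed downwards; [enumeration_perm] then turns it into a permutation of
    the indices. *)
Lemma enumeration_axiomP I :
  [/\ forall x, exists i, I x i,
      forall x y i j, I x i -> I y j ->
        (i = j <-> trace_le x y \/ trace_le y x) &
      forall x i j, I x j -> S i j -> exists y, I y i] <->
  exists f : index -> index, bijective f /\
    forall x i, I x i <->
      exists k, x.1 = (trace_point (f k)).1 /\ index_val k = h i.
Proof.
have [g hK gK] := h_bij; have h_inj := can_inj hK.
split=> [[/choice[v Iv] I_eq I_down]|[f [[f' fK f'K] IP]]].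
  pose K k := h (v (trace_point k)).
  have K_inj : injective K.
    move=> k l /h_inj E; apply: trace_point_inj.
    exact/comparableE/(I_eq _ _ _ _ (Iv _) (Iv _)).
  have I_K x i k : x.1 = (trace_point k).1 -> I x i -> h i = K k.
    move=> xk Ixi; congr h; apply/(I_eq _ _ _ _ Ixi (Iv _)).
    exact/comparableE.
  (* [p] sends a trace to its number; the wanted [f] is the inverse, sending a number to the trace
     that carries it. *)
  have [|p [f pK fK] pP] := enumeration_perm K_inj.
    move=> k n Kk.
    have [|y Iy] := I_down _ (g n) _ (Iv (trace_point k)); first by apply/hP; rewrite gK.
    by have [l yl] := trace_pointP y; exists l; rewrite -(I_K _ _ _ yl Iy) gK.
  exists f; split; first by exists p.
  move=> x i; split=> [Ixi|[k [xk ki]]].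
    have [l xl] := trace_pointP x; exists (p l).
    by rewrite pK pP; split=> //; rewrite -(I_K _ _ _ xl Ixi).
  suff -> : i = v x by [].
  by apply: h_inj; rewrite (I_K _ _ _ xk (Iv x)) -pP fK.
split.
- move=> x; have [k xk] := trace_pointP x.
  by exists (g (index_val (f' k))); apply/IP; exists (f' k); rewrite f'K gK.
- move=> x y i j /IP[k [xk ki]] /IP[l [yl lj]]; rewrite comparableE xk yl.
  split=> [ij|/trace_point_inj/(can_inj fK) kl].
    by move: ki; rewrite ij -lj => /index_val_inj->.
  by apply: h_inj; rewrite -ki -lj kl.
- move=> x i j /IP[k [_ kj]] /hP ij; move: kj; rewrite ij.
  move=> /index_val_down[l li]; exists (trace_point (f l)).
  by apply/IP; exists l.
Qed.

End TeamStructure.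

(** This turns cardinality into a first-order condition on numbers: the size is the first number
    that is no index. It has a predecessor since teams are nonempty, and an infinite team has no
    such number. *)
Lemma team_cardP m (T : team m) n :
  (team_set T #= `I_n)%card <->
  ~ (exists k : index_type (team_index T), index_val k = n) /\
  exists k : index_type (team_index T), (index_val k).+1 = n.
Proof.
have T_card : (team_set T #= [set: index_type (team_index T)])%card.
  by apply: inj_card_eq => k l _ _ /(@team_inj _ T).
rewrite (card_eql T_card).
case: (team_index T) => [N|] /=.
  rewrite -(card_eql (@card_II N.+1)); split=> [/card_eq_II <-|[no [k kn]]].
    split; last by exists ord_max.
    by move=> [k kN]; have := ltn_ord k; rewrite kN ltnn.
  apply/card_eq_II/eqP; rewrite -kn eqn_leq ltn_ord andbT ltnNge.
  apply/negP => le_k; case: no.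
  by have lt_n : n < N.+1; [rewrite -kn|exists (Ordinal lt_n)].
split=> [nat_n|[[]]]; last by exists n.
by case: infinite_nat; exists n; rewrite card_eq_sym // card_eq_sym.
Qed.

(** * Definability of the encoding *)

Section EncodingRelation.
Variables (m : nat) (T : team m).
Let M := (team_set T * nat)%type.
Let index := index_type (team_index T).
Variables (S I Pos : M -> M -> Prop) (h : M -> nat) (f : index -> index).
Hypothesis h_bij : bijective h.
Hypothesis f_bij : bijective f.
Hypothesis hP : forall x y, S x y <-> h y = (h x).+1.
Hypothesis PosP : forall x j, Pos x j <-> h j = x.2.
Hypothesis IP : forall x i, I x i <->
  exists k, x.1 = (trace_point (f k)).1 /\ index_val k = h i.

(** Finiteness of the set of propositions enters here: [k] ranges over ['I_m], so its quantifier can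
    become a finite disjunction over numerals. The second disjunct uses the description of the size
    from [team_cardP]. *)
Definition encoding_axiom (R : M -> M -> M -> M -> Prop) :=
  forall a b c d, R a b c d <->
  (numeral S 0 a /\ exists x, I x b /\ Pos x c /\
     exists k : 'I_m, numeral S k d /\ k \in (val x.1 : trace m) x.2) \/
  (numeral S 1 a /\ b = c /\ c = d /\ ~ (exists x, I x b) /\
     exists x b', S b' b /\ I x b').

Lemma encoding_axiomP R :
  encoding_axiom R <->
  forall a b c d, R a b c d <->
    encoding (team_perm f_bij) [tuple h a; h b; h c; h d].
Proof.
have [g hK gK] := h_bij; have h_inj := can_inj hK.
have I_ex b : (exists x, I x b) <-> exists k : index, index_val k = h b.
  split=> [[x /IP[k [_ kb]]]|[k kb]]; first by exists k.
  by exists (trace_point (f k)); apply/IP; exists k.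
suff E a b c d :
    (numeral S 0 a /\ exists x, I x b /\ Pos x c /\
     exists k : 'I_m, numeral S k d /\ k \in (val x.1 : trace m) x.2) \/
    (numeral S 1 a /\ b = c /\ c = d /\ ~ (exists x, I x b) /\
     exists x b', S b' b /\ I x b') <->
    encoding (team_perm f_bij) [tuple h a; h b; h c; h d].
  by split=> H a b c d; rewrite H E.
rewrite !(numeralP h_bij hP).
split=> [[[a0 [x [/IP[k [xk kb]] [/PosP cx [p [/(numeralP h_bij hP) dp px]]]]]]|]|].
- left; exists k, (h c), p; split; last by apply: val_inj; rewrite /= a0 kb dp.
  by move: px; rewrite cx /= xk.
- move=> [a1 [<- [<- [no_b [x [b' [/hP bb' Ixb']]]]]]].
  right; exists (h b); split; last by apply: val_inj; rewrite /= a1.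
  (* The permuted team has the same index set, so [I_ex] speaks about its indices too. *)
  apply/(@team_cardP _ (team_perm f_bij)); split; first by move/I_ex.
  have /I_ex[k kb'] : exists x, I x b' by exists x.
  by exists k; rewrite kb' bb'.
move=> [[k [j [p [px /(congr1 val) /= [-> hb hc hd]]]]]|H]; [left|right].
  split=> //; exists ((trace_point (f k)).1, j); rewrite PosP; split.
    by apply/IP; exists k.
  by split=> //; exists p; split=> //; apply/(numeralP h_bij hP).
move: H => [n [/(@team_cardP _ (team_perm f_bij)) [no_n [k kn]]]].
move=> /(congr1 val) /= [-> hb hc hd]; split=> //.
split; first by apply: h_inj; rewrite hb.
split; first by apply: h_inj; rewrite hc.
split; first by move/I_ex; rewrite hb.
(* The number before the size is the last index [k]; a point on the trace numbered by it is the
   witness. *)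
have [x Ix] : exists x, I x (g (index_val k)).
  by apply/I_ex; exists k; rewrite gK.
by exists x, (g (index_val k)); rewrite hP hb gK.
Qed.

End EncodingRelation.

(** * The sentence *)

(** De Bruijn indices in an arbitrary large enough scope; index 4 is written [lift ord0 v3]
    below. *)
Definition v0 n : 'I_n.+1 := ord0.
Definition v1 n : 'I_n.+2 := @Ordinal n.+2 1 isT.
Definition v2 n : 'I_n.+3 := @Ordinal n.+3 2 isT.
Definition v3 n : 'I_n.+4 := @Ordinal n.+4 3 isT.
Arguments v0 {n}.
Arguments v1 {n}.
Arguments v2 {n}.
Arguments v3 {n}.

Fixpoint numeral_formula (V : vocabulary) G (X : relvar G 2) k n (x : 'I_n) :
    formula V G n :=
  match k with
  | 0 => Not (Ex1 (atom2 X v0 (lift ord0 x)))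
  | k'.+1 => Ex1 (And (atom2 X v0 (lift ord0 x)) (numeral_formula V X k' v0))
  end.

Arguments numeral_formula {V G} X k {n} x.

Lemma sat_numeral_formula V (M : structure V) G (X : relvar G 2) k n (x : 'I_n)
    (r : rel_env M G) (e : n.-tuple M) :
  sat (numeral_formula X k x) r e <->
  numeral (fun a b => rel_lookup X r [tuple a; b]) k (tnth e x).
Proof.
elim: k n x e => [|k IH] n x e.
  split=> H [w Hw]; apply: H; exists w.
    by apply/sat_atom2; rewrite tnthS.
  by move/sat_atom2: Hw; rewrite tnthS.
split=> [[w [/sat_atom2 Hw /IH Hk]]|[w [Hw Hk]]]; exists w.
  by rewrite tnthS in Hw.
by split; [apply/sat_atom2; rewrite tnthS|apply/IH].
Qed.

Section SimulationFormula.
Variable m : nat.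
Local Notation V := (trace_voc m).

Definition le_atom G n (x y : 'I_n) : formula V G n :=
  @Rel V G n (TLe m) (fun i => Var V (tnth [tuple x; y] i)).
Definition prop_atom G n (p : 'I_m) (x : 'I_n) : formula V G n :=
  @Rel V G n (TP p) (fun _ => Var V x).

Section SatOrder.
Variables (T : team m) (G : seq nat) (n : nat).
Local Notation M := (trace_structure (team_set T)).
Variables (r : rel_env M G) (e : n.-tuple M).

Lemma sat_le_atom x y :
  sat (M := M) (le_atom G x y) r e <-> trace_le (tnth e x) (tnth e y).
Proof. by rewrite /= !tnth_mktuple. Qed.

Lemma sat_prop_atom p x :
  sat (M := M) (prop_atom G p x) r e <->
  p \in (val (tnth e x).1 : trace m) (tnth e x).2.
Proof. by rewrite /= !tnth_mktuple. Qed.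

End SatOrder.

(** From the innermost binder outwards: trace number, position, multiplication, addition, successor.
    The code comes in front of them as the free variable of [phi], so [4 :: base] is the context
    [[:: 4] ++ base] of the translation. *)
Definition base : seq nat := [:: 2; 2; 3; 3; 2].
Definition mul_base : relvar base 3 := RVThere _ (RVThere _ (RVHere _ _)).
Definition add_base : relvar base 3 := RVThere _ (RVThere _ (RVThere _ (RVHere _ _))).

Definition rel_code : relvar (4 :: base) 4 := RVHere _ _.
Definition rel_idx : relvar (4 :: base) 2 := RVThere _ (RVHere _ _).
Definition rel_pos : relvar (4 :: base) 2 := RVThere _ (RVThere _ (RVHere _ _)).
Definition rel_mul : relvar (4 :: base) 3 := RVThere _ mul_base.
Definition rel_add : relvar (4 :: base) 3 := RVThere _ add_base.
Definition rel_succ : relvar (4 :: base) 2 :=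
  RVThere _ (RVThere _ (RVThere _ (RVThere _ (RVThere _ (RVHere _ _))))).

Local Notation axiom := (formula V (4 :: base) 0).

Definition succ_formula : axiom :=
  And (All1 (Ex1 (atom2 rel_succ v1 v0)))
  (And (All1 (All1 (All1 (Imp (atom2 rel_succ v2 v1)
      (Imp (atom2 rel_succ v2 v0) (eq_atom _ v1 v0))))))
  (And (All1 (All1 (All1 (Imp (atom2 rel_succ v2 v0)
      (Imp (atom2 rel_succ v1 v0) (eq_atom _ v2 v1))))))
  (Ex1 (And (Not (Ex1 (atom2 rel_succ v0 v1)))
    (All2 (k := 1) (Imp (atom1 (RVHere _ _) v0)
      (Imp (All1 (All1 (Imp (atom1 (RVHere _ _) v1)
             (Imp (atom2 (RVThere 1 rel_succ) v1 v0) (atom1 (RVHere _ _) v0)))))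
         (All1 (atom1 (RVHere _ _) v0))))))))).

Definition add_formula : axiom :=
  All1 (All1 (All1 (iff_formula (atom3 rel_add v2 v1 v0)
    (Or (And (numeral_formula rel_succ 0 v1) (eq_atom _ v2 v0))
      (Ex1 (Ex1 (And (atom2 rel_succ v1 v3) (And (atom2 rel_succ v0 v2)
        (atom3 rel_add (lift ord0 v3) v1 v0))))))))).

Definition mul_formula : axiom :=
  All1 (All1 (All1 (iff_formula (atom3 rel_mul v2 v1 v0)
    (Or (And (numeral_formula rel_succ 0 v1) (numeral_formula rel_succ 0 v0))
      (Ex1 (Ex1 (And (atom2 rel_succ v1 v3)
        (And (atom3 rel_mul (lift ord0 v3) v1 v0)
             (atom3 rel_add v0 (lift ord0 v3) v2))))))))).

Definition covers_formula n (x y : 'I_n) : formula V (4 :: base) n :=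
  And (le_atom _ y x) (And (Not (eq_atom _ y x))
    (All1 (Imp (le_atom _ v0 (lift ord0 x))
      (Or (eq_atom _ v0 (lift ord0 x)) (le_atom _ v0 (lift ord0 y)))))).

Definition pos_formula : axiom :=
  All1 (All1 (iff_formula (atom2 rel_pos v1 v0)
    (Or (And (All1 (Imp (le_atom _ v0 v2) (eq_atom _ v0 v2)))
             (numeral_formula rel_succ 0 v0))
      (Ex1 (Ex1 (And (covers_formula v3 v1)
        (And (atom2 rel_succ v0 v2) (atom2 rel_pos v1 v0)))))))).

Definition idx_formula : axiom :=
  And (All1 (Ex1 (atom2 rel_idx v1 v0)))
  (And (All1 (All1 (All1 (All1 (Imp (atom2 rel_idx v3 v1)
      (Imp (atom2 rel_idx v2 v0)
        (iff_formula (eq_atom _ v1 v0)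
                     (Or (le_atom _ v3 v2) (le_atom _ v2 v3)))))))))
  (All1 (All1 (All1 (Imp (atom2 rel_idx v2 v0) (Imp (atom2 rel_succ v1 v0)
      (Ex1 (atom2 rel_idx v0 v2)))))))).

Definition code_formula : axiom :=
  All1 (All1 (All1 (All1 (iff_formula (atom4 rel_code v3 v2 v1 v0)
    (Or (And (numeral_formula rel_succ 0 v3)
             (Ex1 (And (atom2 rel_idx v0 v3) (And (atom2 rel_pos v0 v2)
               (disj_ord (fun p : 'I_m =>
                  And (numeral_formula rel_succ p v1) (prop_atom _ p v0)))))))
        (And (numeral_formula rel_succ 1 v3)
        (And (eq_atom _ v2 v1) (And (eq_atom _ v1 v0)
        (And (Not (Ex1 (atom2 rel_idx v0 v3)))
             (Ex1 (Ex1 (And (atom2 rel_succ v0 (lift ord0 v3))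
                            (atom2 rel_idx v1 v0))))))))))))).

Definition simulation (phi : formula arith_voc [:: 4] 0) : sentence V :=
  Ex2 (Ex2 (Ex2 (Ex2 (Ex2 (Ex2
    (And succ_formula (And add_formula (And mul_formula (And pos_formula
      (And idx_formula (And code_formula
        (translate V add_base mul_base phi)))))))))))).

(** * Meaning of the conjuncts *)

Section SatConjuncts.
Variable T : team m.
Local Notation M := (trace_structure (team_set T)).
Variable r : rel_env M (4 :: base).
Let e : 0.-tuple M := [tuple].
Let S x y := rel_lookup rel_succ r [tuple x; y].
Let Add x y z := rel_lookup rel_add r [tuple x; y; z].
Let Mul x y z := rel_lookup rel_mul r [tuple x; y; z].
Let Pos x y := rel_lookup rel_pos r [tuple x; y].
Let I x y := rel_lookup rel_idx r [tuple x; y].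
Let R x y z w := rel_lookup rel_code r [tuple x; y; z; w].

(* Keeps [/=] from unfolding atoms beyond the reach of the [sat_] lemmas. *)
Opaque atom1 atom2 atom3 atom4 eq_atom le_atom prop_atom numeral_formula.

Lemma sat_succ_formula : sat succ_formula r e <-> successor_axioms S.
Proof.
rewrite /succ_formula /=; setoid_rewrite sat_atom2; setoid_rewrite sat_atom1.
by split=> [[? [? []]]|[]].
Qed.

Lemma sat_add_formula :
  sat add_formula r e <->
  forall x y z, Add x y z <->
    (numeral S 0 y /\ x = z) \/
    exists y' z', S y' y /\ S z' z /\ Add x y' z'.
Proof.
rewrite /add_formula /=; setoid_rewrite sat_numeral_formula.
by setoid_rewrite sat_atom2; setoid_rewrite sat_atom3.
Qed.

Lemma sat_mul_formula :
  sat mul_formula r e <->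
  forall x y z, Mul x y z <->
    (numeral S 0 y /\ numeral S 0 z) \/
    exists y' z', S y' y /\ Mul x y' z' /\ Add z' x z.
Proof.
rewrite /mul_formula /=; setoid_rewrite sat_numeral_formula.
by setoid_rewrite sat_atom2; setoid_rewrite sat_atom3.
Qed.

Lemma sat_pos_formula :
  sat pos_formula r e <->
  forall x j, Pos x j <->
    ((forall y : M, trace_le y x -> y = x) /\ numeral S 0 j) \/
    exists y i, covers x y /\ S i j /\ Pos y i.
Proof.
rewrite /pos_formula /=; setoid_rewrite sat_numeral_formula.
by setoid_rewrite sat_le_atom; setoid_rewrite sat_atom2.
Qed.

Lemma sat_idx_formula :
  sat idx_formula r e <->
  [/\ forall x, exists i, I x i,
      forall x y i j, I x i -> I y j ->
        (i = j <-> trace_le x y \/ trace_le y x) &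
      forall x i j, I x j -> S i j -> exists y, I y i].
Proof.
rewrite /idx_formula /=; setoid_rewrite sat_le_atom; setoid_rewrite sat_atom2.
by split=> [[? []]|[]].
Qed.

Lemma sat_code_formula : sat code_formula r e <-> encoding_axiom S I Pos R.
Proof.
rewrite /code_formula /encoding_axiom /=; setoid_rewrite sat_disj_ord => /=.
setoid_rewrite sat_numeral_formula; setoid_rewrite sat_prop_atom.
by setoid_rewrite sat_atom4; setoid_rewrite sat_atom2.
Qed.

End SatConjuncts.
End SimulationFormula.

(** * Correctness of the sentence *)

Section Simulation.
Variables (m : nat) (phi : formula arith_voc [:: 4] 0) (T : team m).
Local Notation M := (trace_structure (team_set T)).
Local Notation index := (index_type (team_index T)).

(** The axioms fix all guesses up to the choice of [h] and [f]. The truth value of the translation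
    does not depend on [h], by [sat_translate], so only [f] remains. *)
Lemma sat_simulation :
  models M (simulation m phi) <->
  exists (f : index -> index) (f_bij : bijective f),
    arith_models phi (encoding (team_perm f_bij)).
Proof.
have translateP (h : M -> nat) (b : rel_env M base) (A : set (4.-tuple nat))
    (R : set (4.-tuple M)) :
    bijective h ->
    (forall x y z : M, rel_lookup add_base b [tuple x; y; z] <-> h x + h y = h z) ->
    (forall x y z : M, rel_lookup mul_base b [tuple x; y; z] <-> h x * h y = h z) ->
    (forall x y z w : M, R [tuple x; y; z; w] <-> A [tuple h x; h y; h z; h w]) ->
    sat (translate (trace_voc m) add_base mul_base phi) (R, b) [tuple] <->
    arith_models phi A.
  move=> h_bij addP mulP RP.
  (* The code is the preimage of [A], so the environment is the pulled-back [(A, tt)] followed by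
     [b]. *)
  have -> : R = fun a => A (map_tuple h a).
    apply/funext => a; apply/propext.
    have -> : a = [tuple tnth a v0; tnth a v1; tnth a v2; tnth a v3].
      by case: a => -[|x [|y [|z [|w []]]]] // i; apply: val_inj.
    by rewrite RP; split; congr (A _); apply: val_inj.
  rewrite (sat_translate h_bij addP mulP phi (A, tt) [tuple]) /arith_models.
  by split; congr (sat phi _ _); apply: val_inj.
split=> [[S [Add [Mul [Pos [I [R]]]]]]|[f [f_bij fP]]].
  case=> /sat_succ_formula/successor_axiomsP[h h_bij hP].
  case=> /sat_add_formula/(addition_axiomP h_bij hP) addP.
  case=> /sat_mul_formula/(multiplication_axiomP h_bij hP _ addP) mulP.
  case=> /sat_pos_formula/(position_axiomP h_bij hP) PosP.
  case=> /sat_idx_formula/(enumeration_axiomP h_bij hP)[f [f_bij IP]].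
  case=> /sat_code_formula/(encoding_axiomP h_bij f_bij hP PosP IP) RP tr.
  by exists f, f_bij; apply: (translateP h _ _ _ h_bij addP mulP RP).1 tr.
(* Any bijection will do; the witnesses are the relations that the axioms force for [h] and [f]. *)
have [h h_bij] := exists_enumeration T.
exists (fun a => h (tnth a v1) = (h (tnth a v0)).+1).
exists (fun a => h (tnth a v0) + h (tnth a v1) = h (tnth a v2)).
exists (fun a => h (tnth a v0) * h (tnth a v1) = h (tnth a v2)).
exists (fun a => h (tnth a v1) = (tnth a v0).2).
exists (fun a => exists k : index,
  (tnth a v0).1 = (trace_point (f k)).1 /\ index_val k = h (tnth a v1)).
exists (fun a => encoding (team_perm f_bij)
  [tuple h (tnth a v0); h (tnth a v1); h (tnth a v2); h (tnth a v3)]).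
split; first by apply/sat_succ_formula/successor_axiomsP; exists h.
split; first by apply/sat_add_formula/(addition_axiomP h_bij).
split; first by apply/sat_mul_formula/(multiplication_axiomP h_bij).
split; first by apply/sat_pos_formula/(position_axiomP h_bij).
split; first by apply/sat_idx_formula/(enumeration_axiomP h_bij) => //; exists f.
split; first by apply/sat_code_formula/(encoding_axiomP h_bij f_bij).
exact/(translateP h _ (encoding (team_perm f_bij)) _ h_bij).
Qed.

End Simulation.

Theorem theorem6 (m : nat) (phi : formula arith_voc [:: 4] 0)
    (phi_inv : trace_order_invariant m phi) :
  exists psi : sentence (trace_voc m),
    forall T : team m,
      models (trace_structure (team_set T)) psi <->
      arith_models phi (encoding T).
Proof.
exists (simulation m phi) => T; rewrite sat_simulation.
(* The guessed order is arbitrary, and invariance carries the truth of [phi] back to the given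
   one. *)
split=> [[f [f_bij]]|phi_T]; first by rewrite -phi_inv.
(* The given order itself is guessed; the identity is bijective as an involution. *)
by exists id, (inv_bij (fun=> erefl)); rewrite -phi_inv.
Qed.
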